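(* Let $a_1$ be a nonzero integer and $f := X^2 - a_1X - 1$. Then $\mathcal{R}(f) = \mathbb{Z}^+$; that is, for every integer $n \ge 1$ there exist $\bm{x} \in \mathcal{L}(f)$ and an integer $m \ge 1$ such that $\rho(\bm{x}; m) = n$. Moreover, for a given $n \ge 1$, one can choose such $\bm{x}$ and $m$ so that additionally $x_j \not\equiv 0 \pmod m$ for every $j \ge 0$ if and only if either $|a_1| = 1$ and $n \ge 4$, or $|a_1| \ge 2$.
   Context: For a monic polynomial $f = X^k - a_1X^{k-1} - \cdots - a_k \in \mathbb{Z}[X]$, $\mathcal{L}(f)$ denotes the set of integer sequences $\bm{x} = (x_n)_{n\ge 0}$ satisfying $x_n = a_1x_{n-1} + \cdots + a_kx_{n-k}$ for all $n \ge k$. For $\bm{x}$ an integer sequence and an integer $m \ge 1$, $\rho(\bm{x}; m) := \#\{x_n \bmod m : n \ge 0\}$ is the number of distinct residues of $\bm{x}$ modulo $m$. Finally $\mathcal{R}(f) := \{\rho(\bm{x}; m) : \bm{x} \in \mathcal{L}(f),\ m \in \mathbb{Z}^+\}$. *)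

(* Defs.v *)
From mathcomp Require Import all_boot all_order all_algebra.
From mathcomp Require Import boolp.
Set Implicit Arguments. Unset Strict Implicit. Unset Printing Implicit Defensive.
Import Order.TTheory GRing.Theory Num.Theory.
Local Open Scope ring_scope.

Definition inL (a1 : int) (x : nat -> int) : Prop :=
  forall n : nat, x n.+2 = a1 * x n.+1 + x n.

Definition rho (x : nat -> int) (m : nat) : nat :=
  #|[set r : 'I_m | `[< exists k : nat, ((x k) %% (m%:Z))%Z = (nat_of_ord r)%:Z >]]|.

(* Main.v *)
Require Import Defs.
From mathcomp Require Import all_boot all_order all_algebra.
From mathcomp Require Import boolp zify ring.
Set Implicit Arguments. Unset Strict Implicit. Unset Printing Implicit Defensive.
Import Order.TTheory GRing.Theory Num.Theory.
Local Open Scope ring_scope.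

(* Reversing a sequence that is periodic modulo m changes the sign of a, so one
   may assume a >= 1. Let U and V be the Lucas sequences of X^2 - aX - 1, with
   unit root e. For T odd, V_T = - N(e^T - 1) = N(e^T + 1), and the sequences
   U_j + s (-1)^j U_{T-j} (s = 1, -1) satisfy x_{j+T} = s x_j modulo V_T. Their T
   first terms are nonzero, below V_T / 2 in absolute value, and distinct in
   absolute value, whence n = T and n = 2T. For 4 | n = 2(k+1) one takes V modulo
   V_{k+1} + V_{k-1}: it is invariant, up to signs, under the reflections at 0 and
   k, so its residues are +-V_0, ..., +-V_k. Only a = 2, where V_0 = V_1, and
   a few small n need other choices. *)

(** * Congruences modulo m *)

Local Notation "x =[ m ]= y" := (is_true (m%:Z %| x - y)%Z)
  (at level 70, no associativity).

Lemma cong_refl m (x : int) : x =[m]= x.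
Proof. by rewrite subrr dvdz0. Qed.

Lemma cong_sym {m} {x y : int} : x =[m]= y -> y =[m]= x.
Proof. by rewrite -[y - x]opprB rpredN. Qed.

Lemma cong_trans {m} {y x z : int} : x =[m]= y -> y =[m]= z -> x =[m]= z.
Proof.
move=> xy yz; have -> : x - z = (x - y) + (y - z) by ring.
exact: rpredD.
Qed.

Lemma congD {m} {x y z t : int} : x =[m]= y -> z =[m]= t -> x + z =[m]= y + t.
Proof. by move=> xy zt; rewrite opprD addrACA rpredD. Qed.

Lemma congM {m} (c : int) {x y : int} : x =[m]= y -> c * x =[m]= c * y.
Proof. by move=> xy; rewrite -mulrBr dvdz_mull. Qed.

Lemma congN {m} {x y : int} : x =[m]= y -> - x =[m]= - y.
Proof. by move=> xy; rewrite -opprD rpredN. Qed.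

Lemma cong_dvd {m} {x y : int} : x =[m]= y -> (m%:Z %| x)%Z = (m%:Z %| y)%Z.
Proof. by move=> xy; rewrite -{1}[x](subrK y); apply: rpredDl xy. Qed.

(** * Counting residues by representatives *)

(** Two elements of [L] differ by less than m in absolute value, so distinct elements are
    incongruent and [L] is in bijection with the residues met. *)
Lemma rho_size x (m : nat) (L : seq int) :
  uniq L -> (forall v, v \in L -> - m%:Z < 2 * v <= m%:Z) ->
  (forall j, exists2 v, v \in L & x j =[m]= v) ->
  (forall v, v \in L -> exists j, x j =[m]= v) ->
  rho x m = size L.
Proof.
move=> uL bL xL Lx.
(* The interval -m < 2 v <= m is empty for m = 0, and the representative of x_0 lies in it. *)
have m_gt0 : (0 < m)%N by have [v /bL] := xL 0%N; lia.
case: m m_gt0 bL xL Lx => // m _ bL xL Lx.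
pose f (v : int) : 'I_m.+1 := inord `|(v %% m.+1%:Z)%Z|%N.
have fE v : (f v)%:Z = (v %% m.+1%:Z)%Z.
  have v_ge0 : 0 <= (v %% m.+1%:Z)%Z by rewrite modz_ge0.
  have v_lt : (v %% m.+1%:Z)%Z < m.+1%:Z by rewrite ltz_pmod.
  rewrite inordK ?gez0_abs // -ltz_nat gez0_abs //.
have f_inj : {in L &, injective f}.
  move=> u v /bL bu /bL bv /(congr1 (fun i : 'I_m.+1 => i%:Z)).
  rewrite !fE => /eqP; rewrite eqz_mod_dvd => /dvdzP[q Eq].
  suff : q = 0 by move=> q0; move: Eq; rewrite q0; lia.
  have : - m.+1%:Z < q * m.+1%:Z < m.+1%:Z by rewrite -Eq; lia.
  by nia.
rewrite /rho; have -> : [set r : 'I_m.+1 |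
    `[< exists k, (x k %% m.+1)%Z = r >]] = [set r in map f L].
  apply/setP=> r; rewrite !inE; apply/asboolP/mapP => [[k xk]|[v vL ->]].
    have [v vL xv] := xL k; exists v => //; apply/val_inj/eqP => /=.
    by rewrite -eqz_nat fE -xk eqz_mod_dvd.
  have [k xk] := Lx v vL; exists k; apply/eqP.
  by rewrite fE eqz_mod_dvd.
rewrite cardsE -(size_map f); apply/card_uniqP.
by rewrite map_inj_in_uniq.
Qed.

Lemma rho_eq x y m :
  (forall j, exists k, x j =[m]= y k) -> (forall k, exists j, x j =[m]= y k) ->
  rho x m = rho y m.
Proof.
move=> xy yx; rewrite /rho; congr #|pred_of_set _|.
apply/setP=> r; rewrite !inE; apply/asboolP/asboolP => -[k xk].
  have [j xj] := xy k; exists j.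
  by apply/eqP; rewrite -xk eqz_mod_dvd; apply: cong_sym.
have [j xj] := yx k; exists j.
by apply/eqP; rewrite -xk eqz_mod_dvd.
Qed.

(** * Zero-free values and criteria for them *)

(** The recurrence is required modulo m only, and a period is recorded: reversing a sequence in
    [zero_free_rhoN] uses the period and keeps the recurrence only modulo m. [zero_free_rho_inL]
    returns to integer solutions. *)
Definition zero_free_rho (a : int) (n : nat) : Prop :=
  exists (x : nat -> int) (m P : nat),
  [/\ (0 < m)%N, (0 < P)%N, forall j, x j.+2 =[m]= a * x j.+1 + x j &
      forall j, x (j + P)%N =[m]= x j]
  /\ (rho x m = n /\ forall j, ~~ (m%:Z %| x j)%Z).

Lemma cong_period x m P j q :
  (forall j, x (j + P)%N =[m]= x j) -> x (j + q * P)%N =[m]= x j.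
Proof.
move=> xP; elim: q => [|q IH]; first by rewrite addn0 cong_refl.
by rewrite mulSnr addnA; apply: cong_trans (xP _) IH.
Qed.

Fixpoint lin (a x0 x1 : int) (n : nat) {struct n} : int :=
  match n with
  | 0 => x0
  | 1 => x1
  | (k.+1 as k').+1 => a * lin a x0 x1 k' + lin a x0 x1 k
  end.

Lemma linSS a x0 x1 n :
  lin a x0 x1 n.+2 = a * lin a x0 x1 n.+1 + lin a x0 x1 n.
Proof. by []. Qed.

Lemma zero_free_rho_inL a n : zero_free_rho a n ->
  exists (x : nat -> int) (m : nat),
    [/\ inL a x, (1 <= m)%N, rho x m = n & forall j : nat, ~~ (m%:Z %| x j)%Z].
Proof.
case=> x [m [P [[m_gt0 P_gt0 xrec _] [<- xn0]]]].
pose y := lin a (x 0%N) (x 1%N).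
have yx j : y j =[m]= x j /\ y j.+1 =[m]= x j.+1.
  elim: j => [|j [IH0 IH1]]; first by rewrite !cong_refl.
  split=> //; rewrite /y linSS.
  exact: cong_trans (congD (congM a IH1) IH0) (cong_sym (xrec j)).
exists y, m; split=> //.
  by apply: rho_eq => j; exists j; case: (yx j).
by move=> j; rewrite (cong_dvd (proj1 (yx j))).
Qed.

(* Modulo m the sequence is reversed by j |-> x (j (2 P - 1)), where doubling the
   period P keeps the factor nonzero. *)
Lemma zero_free_rhoN a n : zero_free_rho a n -> zero_free_rho (- a) n.
Proof.
case=> x [m [P [[m_gt0 P_gt0 xrec xP] [<- xn0]]]].
pose p := (P + P).-1; have pE : p.+1 = (2 * P)%N by rewrite /p; lia.
have xp j q : x (j + q * p.+1)%N =[m]= x j.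
  by rewrite pE mulnA; apply: (@cong_period x m P).
exists (fun j => x (j * p)%N), m, p.+1; split; split => //.
- move=> j; have e1 : (j.+2 * p).+2 = (j * p + 2 * p.+1)%N by lia.
  have e2 : (j.+2 * p).+1 = (j.+1 * p + 1 * p.+1)%N by lia.
  have := xrec (j.+2 * p)%N; rewrite e1 e2 => E.
  have mid := congD (congM (-a) (xp (j.+1 * p)%N 1%N)) (xp (j * p)%N 2%N).
  refine (cong_trans _ mid).
  by have /dvdzP[c Ec] := E; apply/dvdzP; exists (- c); rewrite [RHS]mulNr -Ec; ring.
- by move=> j; have := xp (j * p)%N p; rewrite mulnDl [(p.+1 * p)%N]mulnC.
- apply: rho_eq => j; first by exists (j * p)%N; exact: cong_refl.
  (* p is -1 modulo p + 1, so reversing twice gives back the index j. *)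
  exists (j * p)%N; have -> : (j * p * p = j + j * (p.-1) * p.+1)%N.
    have : (p = p.-1.+1)%N by rewrite /p; lia.
    by move: p.-1 => r ->; lia.
  exact: xp.
Qed.

Lemma zero_free_rhoI (a : int) (x : nat -> int) (m P : nat) (L : seq int) :
  (0 < P)%N -> (forall j, x j.+2 =[m]= a * x j.+1 + x j) ->
  (forall j, x (j + P)%N =[m]= x j) ->
  uniq L -> (forall v, v \in L -> v != 0 /\ - m%:Z < 2 * v <= m%:Z) ->
  (forall j, exists2 v, v \in L & x j =[m]= v) ->
  (forall v, v \in L -> exists j, x j =[m]= v) ->
  zero_free_rho a (size L).
Proof.
move=> P_gt0 xrec xP uL bL xL Lx.
have m_gt0 : (0 < m)%N by have [v /bL] := xL 0%N; lia.
exists x, m, P; split; split=> //.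
  by apply: rho_size => // v /bL [].
move=> j; have [v /bL [v0 bv] xv] := xL j; rewrite (cong_dvd xv).
apply/dvdzP => -[q vE]; move: v0 bv; rewrite {}vE => v0 bv.
have q0 : q != 0 by apply: contraNneq v0 => ->; rewrite mul0r.
have [q1|q1] : 1 <= q \/ q <= -1 by lia.
  by nia.
by nia.
Qed.

(** With distinct absolute values strictly between 0 and m / 2, the numbers v and -v for v in [L]
    are pairwise incongruent, hence the factor 2. *)
Lemma zero_free_rho_pm (a : int) (x : nat -> int) (m P : nat) (L : seq int) :
  (0 < P)%N -> (forall j, x j.+2 =[m]= a * x j.+1 + x j) ->
  (forall j, x (j + P)%N =[m]= x j) ->
  uniq (map absz L) -> (forall v, v \in L -> 0 < 2 * `|v| < m%:Z) ->
  (forall j, exists2 v, v \in L & x j =[m]= v \/ x j =[m]= - v) ->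
  (forall v, v \in L -> (exists j, x j =[m]= v) /\ (exists j, x j =[m]= - v)) ->
  zero_free_rho a (2 * size L).
Proof.
move=> P_gt0 xrec xP uL bL xL Lx.
have -> : (2 * size L = size (L ++ map -%R L))%N.
  by rewrite size_cat size_map mul2n addnn.
have absL : {in L &, injective absz}.
  move=> u v uinL vinL Euv; have := nth_index 0 uinL; have := nth_index 0 vinL.
  rewrite -!index_mem in uinL vinL => Ev Eu.
  have := nth_uniq 0%N _ _ uL; rewrite size_map => /(_ _ _ uinL vinL).
  by rewrite !(nth_map 0) // Eu Ev Euv eqxx => /esym/eqP E; rewrite -Eu -Ev E.
apply: (zero_free_rhoI P_gt0 xrec xP) => //.
- rewrite cat_uniq (map_uniq uL) map_inj_uniq ?(map_uniq uL); last exact: oppr_inj.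
  rewrite andbT /=; apply/hasPn => _ /mapP[u uL' ->]; apply/negP => uL2.
  have E := absL _ _ uL2 uL' (abszN u); have := bL _ uL'; lia.
- move=> v; rewrite mem_cat => /orP[/bL|/mapP[u /bL ? ->]]; lia.
- move=> j; have [v vL [xv|xv]] := xL j.
    by exists v; rewrite // mem_cat vL.
  by exists (- v); rewrite // mem_cat map_f ?orbT.
move=> v; rewrite mem_cat => /orP[/Lx[]//|/mapP[u /Lx[_ ?] ->] //].
Qed.

(** Both sides satisfy the recurrence modulo m, so two consecutive indices decide. It serves periods
    (s = 1) and antiperiods (s = -1). *)
Lemma lin_period (a : int) (m P : nat) (s : int) (x : nat -> int) :
  (forall j, x j.+2 =[m]= a * x j.+1 + x j) ->
  x P =[m]= s * x 0%N -> x P.+1 =[m]= s * x 1%N ->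
  forall j, x (j + P)%N =[m]= s * x j.
Proof.
move=> xrec xP xP1 j.
suff [] : x (j + P)%N =[m]= s * x j /\ x (j.+1 + P)%N =[m]= s * x j.+1 by [].
elim: j => [//|j [IH0 IH1]]; split=> //.
apply: (cong_trans (xrec _)); apply: (cong_trans (congD (congM a IH1) IH0)).
have := congM (- s) (xrec j).
by have -> : - s * x j.+2 - - s * (a * x j.+1 + x j) =
  a * (s * x j.+1) + s * x j - s * x j.+2 by ring.
Qed.

(** * Growth of the Lucas sequence U *)

Local Notation U a := (lin a 0 1).

Lemma U_ge0 (a : int) n : 1 <= a -> 0 <= U a n.
Proof.
move=> a_gt0; suff [] : 0 <= U a n /\ 0 <= U a n.+1 by [].
by elim: n => [|n [IH0 IH1]] //; rewrite linSS; split=> //; nia.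
Qed.

Lemma U_step (a c : int) n : 1 <= a -> c <= a -> c * U a n.+1 + U a n <= U a n.+2.
Proof. by move=> a_gt0 ca; rewrite linSS lerD2r ler_wpM2r ?U_ge0. Qed.

Lemma U_gt0 (a : int) n : 1 <= a -> (0 < n)%N -> 0 < U a n.
Proof.
move=> a_gt0; case: n => // n _; elim: n => [//|n IH].
have := U_step n a_gt0 a_gt0; have := @U_ge0 a n a_gt0; nia.
Qed.

Lemma U_mono (a : int) i j : 1 <= a -> (i <= j)%N -> U a i <= U a j.
Proof.
move=> a_gt0; elim: j => [|j IH]; first by rewrite leqn0 => /eqP ->.
rewrite leq_eqVlt => /orP[/eqP ->//|/IH le_ij]; apply: le_trans le_ij _.
case: j {IH} => // j; have := U_step j a_gt0 a_gt0.
by have := @U_ge0 a j a_gt0; have := @U_ge0 a j.+1 a_gt0; nia.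
Qed.

(** If a >= 2 or p' >= p + 2, then U_{p'} >= 2 U_p + U_{p-1} > U_p + U_q + U_{q'}. This leaves a = 1
    and p' = p + 1, where p + q = 3 would fail: U_2 + U_1 = U_3 + U_0. *)
Lemma U_neq (a : int) p q p' q' (e e' : int) : 1 <= a ->
  (e = 1) \/ (e = -1) -> (e' = 1) \/ (e' = -1) ->
  (q < p)%N -> (q' < q)%N -> (p + q = p' + q')%N -> odd (p + q) ->
  (a = 1 -> (5 <= p + q)%N) ->
  U a p + e * U a q != U a p' + e' * U a q'.
Proof.
move=> a_gt0 He He' qp q'q pq odd_pq pq5.
have [c Ec] : exists c, q = c.+1 by exists q.-1; lia.
have [d Ed] : exists d, p = d.+2 by exists p.-2; lia.
have Uq := @U_gt0 a q a_gt0; have Ud := @U_ge0 a d a_gt0.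
have Ud1 := @U_gt0 a d.+1 a_gt0 isT.
have Ud2 := U_step d a_gt0 a_gt0; have Ud3 := U_step d.+1 a_gt0 a_gt0.
have qd : U a q <= U a d.+1 by apply: U_mono; lia.
have q'c : U a q' <= U a c by apply: U_mono; lia.
have cd : U a c <= U a d by apply: U_mono; lia.
have Uq' := @U_ge0 a q' a_gt0.
suff [big|[Ea [Ep' Eq']]] : 2 * U a p + U a d.+1 <= U a p' \/
    a = 1 /\ p' = p.+1 /\ q' = c.
- by rewrite Ed in big *; case: He He' => -> [->|->]; lia.
- subst a p' q'; rewrite Ed (linSS 1 0 1 d.+1) mul1r.
  (* Now U_{p'} = U_p + U_{p-1}, so e U_q is compared with U_{p-1} + e' U_{q-1}. As p + q is odd, q
     = p - 1 or q <= p - 3. In the first case p + q >= 5 makes U_{q-1} nonzero; in the second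
     U_{p-1} > U_q + U_{q-1}. *)
  have [cdE|cd2] : c = d \/ (c.+2 <= d)%N by lia.
    have d_gt0 : (0 < d)%N by lia.
    have := @U_gt0 1 d a_gt0 d_gt0; have := @U_mono 1 d d.+1 a_gt0 (leqnSn d).
    by rewrite Ec cdE; case: He He' => -> [->|->]; lia.
  have c3 : U 1 c.+3 <= U 1 d.+1 by apply: U_mono.
  have := U_step c.+1 a_gt0 a_gt0; have := U_step c a_gt0 a_gt0.
  by rewrite Ec in Uq *; case: He He' => -> [->|->]; lia.
have [a2|a1] : 2 <= a \/ a = 1 by lia.
  left; have p1 : U a d.+3 <= U a p' by apply: U_mono; lia.
  by have := U_step d.+1 a_gt0 a2; rewrite Ed; lia.
have [p2|p1] : (p.+2 <= p')%N \/ p' = p.+1 by lia.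
  left; have : U a d.+4 <= U a p' by apply: U_mono; lia.
  by have := U_step d.+2 a_gt0 a_gt0; rewrite Ed; lia.
by right; split; [|split=> //; lia].
Qed.

(** * Periods, antiperiods and mirror sequences *)

Lemma anti_period_mod x m P : (0 < P)%N -> (forall j, x (j + P)%N =[m]= - x j) ->
  forall j, exists2 r, (r < P)%N & x j =[m]= x r \/ x j =[m]= - x r.
Proof.
move=> P_gt0 xP; elim/ltn_ind => j IH.
have [jP|Pj] := ltnP j P; first by exists j => //; left; exact: cong_refl.
have [|r rP xr] := IH (j - P)%N; first by lia.
exists r => //; have := xP (j - P)%N; rewrite subnK // => xj.
case: xr => xr; [right | left]; apply: (cong_trans xj); first exact: congN.
by rewrite -[x r]opprK; exact: congN.
Qed.

Lemma anti_period_double x m P : (forall j, x (j + P)%N =[m]= - x j) ->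
  forall j, x (j + (P + P))%N =[m]= x j.
Proof.
move=> xP j; rewrite addnA; apply: (cong_trans (xP _)).
by rewrite -[x j]opprK; exact: congN.
Qed.

Lemma period_mod x m P : (0 < P)%N -> (forall j, x (j + P)%N =[m]= x j) ->
  forall j, exists2 r, (r < P)%N & x j =[m]= x r.
Proof.
move=> P_gt0 xP j; exists (j %% P)%N; first by rewrite ltn_mod.
by rewrite {1}(divn_eq j P) addnC; exact: cong_period.
Qed.

(* Up to sign, the coefficient of e in e^j (e'^T - s), e and e' = - 1 / e being
   the roots of X^2 - a X - 1. *)
Definition mirror (a s : int) (T j : nat) : int :=
  U a j + s * (-1) ^+ j * U a (T - j).

(** For j <= T the function (-1)^j U_{T-j} is again a solution. Past T the truncated subtraction
    breaks this, so [lin] is what continues the sequence. *)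
Lemma lin_mirror (a s : int) T j : (j <= T)%N ->
  lin a (mirror a s T 0) (mirror a s T 1) j = mirror a s T j.
Proof.
have := leqnn j; move: {-2}j => i; elim: j i => [|j IH] i.
  by case: i.
case: i => [//|[//|i]] ij iT.
rewrite linSS !IH; try lia.
rewrite /mirror linSS.
have -> : (T - i = (T - i.+2).+2)%N by lia.
have -> : (T - i.+1 = (T - i.+2).+1)%N by lia.
rewrite linSS !exprS; ring.
Qed.

(** * Mirror sequences modulo V_T for odd T *)

Section Mirror.
Variables (a : int) (T : nat).
Hypotheses (a_gt0 : 1 <= a) (oddT : odd T).
(** For odd T these exclude exactly the failures of [U_double_lt]: T = 1 and T = 3 for a = 1, and T
    = 1 for a = 2. *)
Hypotheses (T1 : a = 1 -> (5 <= T)%N) (T2 : a = 2 -> (3 <= T)%N).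

(** The coincidence U_1 = U_2 at a = 1 would need T = 3. *)
Lemma U_ltn p q : (q < p)%N -> (p + q = T)%N -> U a q < U a p.
Proof.
move=> qp pqT; case: q => [|q] in qp pqT *; first by apply: U_gt0.
have [d pE] : exists d, p = d.+2 by exists p.-2; lia.
have qd : U a q.+1 <= U a d.+1 by apply: U_mono => //; lia.
have Ud1 : 0 < U a d.+1 by apply: U_gt0.
have Ud := @U_ge0 a d a_gt0.
rewrite pE; have [a2|a1] : 2 <= a \/ a = 1 by lia.
  by have := U_step d a_gt0 a2; lia.
have d_gt0 : (0 < d)%N by have := T1 a1; lia.
by have := U_gt0 a_gt0 d_gt0; have := U_step d a_gt0 a_gt0; lia.
Qed.

Lemma U_addn_le p q : (q < p)%N -> (p + q = T)%N -> U a p + U a q <= U a T.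
Proof.
move=> qp pqT; case: q => [|q] in qp pqT *.
  by rewrite -pqT addn0 addr0.
have [d pE] : exists d, p = d.+1 by exists p.-1; lia.
have qd : U a q.+1 <= U a d by apply: U_mono => //; lia.
have pT : U a p.+1 <= U a T by apply: U_mono => //; lia.
by rewrite pE in pT *; have := U_step d a_gt0 a_gt0; lia.
Qed.

(** The right-hand side is V_T = a U_T + 2 U_{T-1}. For a = 1 the claim reduces to U_{T-1} >
    U_{T-2}. With [U_addn_le] it keeps the mirror terms below half the modulus. *)
Lemma U_double_lt : 2 * U a T < U a T.+1 + U a T.-1.
Proof.
have T_gt0 : (0 < T)%N by case: (T) oddT.
have [d TE] : exists d, T = d.+1 by exists T.-1; lia.
have UT := U_gt0 a_gt0 T_gt0; have Ud := @U_ge0 a d a_gt0.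
have -> : U a T.+1 = a * U a T + U a d by rewrite TE.
have -> : T.-1 = d by lia.
have [a3|[a2|a1]] : 3 <= a \/ a = 2 \/ a = 1 by lia.
- have : 3 * U a T <= a * U a T by rewrite ler_wpM2r ?(ltW UT).
  by lia.
- have d_gt0 : (0 < d)%N by have := T2 a2; lia.
  have := U_gt0 a_gt0 d_gt0; have -> : a * U a T = 2 * U a T by rewrite {1}a2.
  by lia.
have [f dE] : exists f, d = f.+2 by exists d.-2; have := T1 a1; lia.
have f_gt0 : (0 < f)%N by have := T1 a1; lia.
have Uf := U_gt0 a_gt0 f_gt0; have a1M y : a * y = y by rewrite a1 mul1r.
have -> : U a T = U a d + U a f.+1 by rewrite TE dE linSS a1M.
have -> : U a d = U a f.+1 + U a f by rewrite dE linSS a1M.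
by rewrite a1M; lia.
Qed.

Variable s : int.
Hypothesis sE : s = 1 \/ s = -1.
Let m : nat := `|(U a T.+1 + U a T.-1)%R|%N.
Let z := mirror a s T.
Let x := lin a (z 0) (z 1).

Lemma mirror_modE : m%:Z = U a T.+1 + U a T.-1.
Proof. by rewrite gez0_abs // addr_ge0 ?U_ge0. Qed.

(** x_T = s x_0 holds exactly, and x_{T+1} - s x_1 is exactly V_T, because (-1)^{T-1} = 1. *)
Lemma lin_mirror_period j : x (j + T)%N =[m]= s * x j.
Proof.
have xz i : (i <= T)%N -> x i = z i := @lin_mirror a s T i.
have T_gt0 : (0 < T)%N by case: (T) oddT.
have xT : x T = s * z 0%N.
  rewrite xz // /z /mirror subnn subn0 expr0 /=.
  by case: sE => ->; ring.
apply: (@lin_period a).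
- by move=> i; rewrite /x linSS; exact: cong_refl.
- by rewrite xT; exact: cong_refl.
have recS t y0 y1 : T = t.+1 -> lin a y0 y1 T.+1 = a * lin a y0 y1 T + lin a y0 y1 t.
  by move=> ->.
have T1E : T = T.-1.+1 by rewrite prednK.
have oddT1 : odd T.-1 = false by move: oddT; rewrite {1}T1E /=; case: odd.
have x1 : x 1%N = s * (s - U a T.-1).
  rewrite xz // /z /mirror expr1 subn1 /=; case: sE => ->; ring.
have xT1 : x T.-1 = U a T.-1 + s.
  rewrite xz ?leq_pred // /z /mirror -signr_odd oddT1 expr0.
  have -> : (T - T.-1 = 1)%N by lia.
  by rewrite /= !mulr1.
have z0 : s * z 0%N = U a T.
  by rewrite /z /mirror subn0 expr0 /=; case: sE => ->; ring.
apply/dvdzP; exists 1; have xTS : x T.+1 = a * x T + x T.-1 := recS _ _ _ T1E.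
by rewrite mirror_modE xTS (recS _ 0 1 T1E) xT xT1 x1 z0; case: sE => ->; ring.
Qed.

Lemma sign_cases j : s * (-1) ^+ j = 1 \/ s * (-1) ^+ j = -1.
Proof. by rewrite -signr_odd; case: sE => ->; case: odd; [right|left|left|right]. Qed.

(** The indices j and T - j differ since T is odd, and by [U_ltn] the term of larger index decides
    the sign. *)
Lemma mirror_abs j : (j < T)%N -> exists p q (e : int),
  [/\ (p + q = T)%N, (q < p)%N, p = maxn j (T - j), e = s * (-1) ^+ j &
      `|z j| = U a p + e * U a q].
Proof.
move=> jT.
have norm_e p q e : e = 1 \/ e = -1 -> (q < p)%N -> (p + q = T)%N ->
    0 <= U a p + e * U a q.
  move=> e1 qp pqT; have := U_ltn qp pqT; have := @U_ge0 a q a_gt0.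
  by case: e1 => ->; lia.
have e1 := sign_cases j.
have [jl|jl] : (T - j < j)%N \/ (j < T - j)%N by lia.
  exists j, (T - j)%N, (s * (-1) ^+ j); split=> //; try lia.
  by rewrite ger0_norm //; apply: norm_e => //; lia.
exists (T - j)%N, j, (s * (-1) ^+ j); split=> //; try lia.
rewrite -(@ger0_norm _ (_ + _ * U a j)); last by apply: norm_e => //; lia.
rewrite /z /mirror; case: e1 => ->; rewrite !(mul1r, mulN1r).
  by rewrite addrC.
by rewrite distrC.
Qed.

Lemma mirror_bound j : (j < T)%N -> 0 < 2 * `|z j| < m%:Z.
Proof.
move=> jT; have [p [q [e [pqT qp _ eE ->]]]] := mirror_abs jT.
have := U_ltn qp pqT; have := U_addn_le qp pqT; have := U_double_lt.
have Uq := @U_ge0 a q a_gt0; rewrite mirror_modE.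
by have := sign_cases j; rewrite -eE => -[->|->]; lia.
Qed.

Lemma mirror_inj i j : (i < T)%N -> (j < T)%N -> `|z i|%N = `|z j|%N -> i = j.
Proof.
wlog : i j / (maxn i (T - i) <= maxn j (T - j))%N.
  move=> W iT jT zij; have /orP[ij|ij] := leq_total (maxn i (T - i)) (maxn j (T - j)).
    exact: W.
  by apply/esym/W.
move=> le_ij iT jT zij.
have [p [q [e [pqT qp pE eE zE]]]] := mirror_abs iT.
have [p' [q' [e' [pqT' qp' pE' eE' zE']]]] := mirror_abs jT.
have e1 : e = 1 \/ e = -1 by rewrite eE; exact: sign_cases.
have e1' : e' = 1 \/ e' = -1 by rewrite eE'; exact: sign_cases.
have w_eq : U a p + e * U a q = U a p' + e' * U a q'.
  by rewrite -zE -zE' -!abszE zij.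
have [lt_pp'|pp'] : (p < p')%N \/ p = p' by lia.
  have := @U_neq a p q p' q' e e' a_gt0 e1 e1' qp; rewrite w_eq eqxx pqT => H.
  by have : false by apply: H => //; lia.
(* With p = p' the indices agree or are i and T - i. These have opposite parity, so the absolute
   values are U_p + U_q and U_p - U_q, with U_q nonzero. *)
have [//|ij] : i = j \/ i = (T - j)%N by lia.
have q0 : (0 < q)%N by lia.
have := @U_gt0 a q a_gt0 q0; have qq' : q = q' by lia.
move: w_eq; rewrite -pp' -qq' eE eE' ij => /addrI.
rewrite -[in LHS]signr_odd -[in RHS]signr_odd oddB ?(ltnW jT) // oddT.
by case: sE => ->; case: (odd j); rewrite /= ?expr0 ?expr1; lia.
Qed.

End Mirror.

(** * The values T and 2T for odd T *)

Lemma uniq_absz_map (f : nat -> int) n :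
  (forall i j, (i < n)%N -> (j < n)%N -> `|f i|%N = `|f j|%N -> i = j) ->
  uniq (map absz (map f (iota 0 n))).
Proof.
move=> f_inj; rewrite -map_comp map_inj_in_uniq ?iota_uniq // => i j.
by rewrite !mem_iota /= add0n; exact: f_inj.
Qed.

(** s = 1 gives the period T and the value T; s = -1 gives the antiperiod T, so every residue comes
    with its negative. *)
Lemma zero_free_rho_odd (a : int) (T : nat) : 1 <= a -> odd T ->
  (a = 1 -> (5 <= T)%N) -> (a = 2 -> (3 <= T)%N) ->
  zero_free_rho a T /\ zero_free_rho a (2 * T)%N.
Proof.
move=> a_gt0 oddT T1 T2; have T_gt0 : (0 < T)%N by case: (T) oddT.
pose m : nat := `|(U a T.+1 + U a T.-1)%R|%N.
pose z s := mirror a s T; pose x s := lin a (z s 0%N) (z s 1%N).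
have xz s j : (j < T)%N -> x s j = z s j by move=> /ltnW; exact: lin_mirror.
have xrec s j : x s j.+2 =[m]= a * x s j.+1 + x s j.
  by rewrite /x linSS; exact: cong_refl.
pose L s := map (z s) (iota 0 T).
have sizeL s : size (L s) = T by rewrite size_map size_iota.
have uL s : s = 1 \/ s = -1 -> uniq (map absz (L s)).
  by move=> s1; apply: uniq_absz_map => i j; exact: mirror_inj.
have LP s v : v \in L s -> exists2 j, (j < T)%N & v = x s j.
  by case/mapP => j; rewrite mem_iota /= add0n => jT ->; exists j; rewrite ?xz.
have xL s j : (j < T)%N -> x s j \in L s.
  by move=> jT; rewrite xz // map_f // mem_iota.
have bL s v : s = 1 \/ s = -1 -> v \in L s -> 0 < 2 * `|v| < m%:Z.
  by move=> s1 /LP[j jT ->]; rewrite xz //; exact: mirror_bound.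
split.
- have s1 : (1 : int) = 1 \/ (1 : int) = -1 by left.
  have xP j : x 1 (j + T)%N =[m]= x 1 j.
    by rewrite -[x 1 j]mul1r; exact: lin_mirror_period.
  rewrite -(sizeL 1); apply: (zero_free_rhoI T_gt0 (xrec 1) xP).
  + exact: map_uniq (uL 1 s1).
  + by move=> v /(bL _ _ s1); lia.
  + move=> j; have [r rT xr] := period_mod T_gt0 xP j.
    by exists (x 1 r); first exact: xL.
  by move=> v /LP[j _ ->]; exists j; exact: cong_refl.
have s1 : (-1 : int) = 1 \/ (-1 : int) = -1 by right.
have xP j : x (-1) (j + T)%N =[m]= - x (-1) j.
  by rewrite -[- x _ j]mulN1r; exact: lin_mirror_period.
rewrite -(sizeL (-1)).
apply: (@zero_free_rho_pm _ _ _ (T + T) _ _ (xrec (-1)) (anti_period_double xP)).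
- by rewrite addn_gt0 T_gt0.
- exact: uL.
- by move=> v; exact: bL.
- move=> j; have [r rT xr] := anti_period_mod T_gt0 xP j.
  by exists (x (-1) r); first exact: xL.
by move=> v /LP[j _ ->]; split; [exists j; exact: cong_refl | exists (j + T)%N].
Qed.

(** * Sequences with two reflections *)

(* x_1 + x_{-1} = 2 x_1 - a x_0 and x_{k+1} + x_{k-1} vanish modulo m, so the
   sequence satisfies x_{c+j} = (-1)^j x_{c-j} for c = 0 and c = k. *)
Lemma zero_free_rho_symmetric (a : int) (x : nat -> int) (m k : nat) (y : nat -> int) :
  odd k -> (forall j, x j.+2 =[m]= a * x j.+1 + x j) ->
  2 * x 1%N =[m]= a * x 0%N -> x k.+1 =[m]= - x k.-1 ->
  (forall j, (j <= k)%N -> x j =[m]= y j) ->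
  (forall i j, (i <= k)%N -> (j <= k)%N -> `|y i|%N = `|y j|%N -> i = j) ->
  (forall j, (j <= k)%N -> 0 < 2 * `|y j| < m%:Z) ->
  zero_free_rho a (2 * k.+1)%N.
Proof.
move=> odd_k xrec x01 xk xy y_inj y_bound.
have k_gt0 : (0 < k)%N by case: (k) odd_k.
have refl j : (j <= k)%N -> x (k + j)%N =[m]= (-1) ^+ j * x (k - j)%N.
  suff [//] : ((j <= k)%N -> x (k + j)%N =[m]= (-1) ^+ j * x (k - j)%N) /\
    ((j.+1 <= k)%N -> x (k + j.+1)%N =[m]= (-1) ^+ j.+1 * x (k - j.+1)%N).
  elim: j => [|j [IH0 IH1]].
    split; first by rewrite addn0 subn0 expr0 mul1r => _; exact: cong_refl.
    by rewrite addn1 subn1 expr1 mulN1r.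
  split=> // jk; rewrite !addnS -!addSn !addSn.
  have := congD (congM a (IH1 (ltnW jk))) (IH0 (ltnW (ltnW jk))).
  rewrite addnS; move/(cong_trans (xrec _)) => h; apply: (cong_trans h).
  have := congM (- (-1) ^+ j) (xrec (k - j.+2)%N).
  rewrite (subnSK jk) (subnSK (ltnW jk)).
  move=> /dvdzP[c Ec]; apply/dvdzP; exists (- c); rewrite [RHS]mulNr -Ec !exprS.
  ring.
(* The two reflections compose to the translation by 2k, with sign (-1)^k = -1. Concretely x_{2k} =
   -x_0 and x_{2k+1} = a x_{2k} + x_{2k-1} = x_1 - a x_0 = -x_1. *)
have anti j : x (j + (k + k))%N =[m]= - x j.
  rewrite -[- x j]mulN1r; apply: (lin_period xrec).
    by have := refl k (leqnn k); rewrite subnn -signr_odd odd_k expr1.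
  have x2k := refl k (leqnn k); have x2k1 := refl k.-1 (leq_pred k).
  have odd_k1 : odd k.-1 = false by case: (k) odd_k => //= n; case: odd.
  have k1E : (k - k.-1 = 1)%N by clear -k_gt0; lia.
  rewrite subnn -signr_odd odd_k expr1 in x2k.
  rewrite k1E -signr_odd odd_k1 expr0 mul1r in x2k1.
  have e : (k + k).+1 = (k + k.-1).+2 by clear -k_gt0; lia.
  have e1 : (k + k)%N = (k + k.-1).+1 by clear -k_gt0; lia.
  rewrite e; apply: (cong_trans (xrec _)); rewrite -e1.
  apply: (cong_trans (congD (congM a x2k) x2k1)).
  move/dvdzP: x01 => [c Ec]; apply/dvdzP; exists c; rewrite -Ec; ring.
have sizeL : size (map y (iota 0 k.+1)) = k.+1 by rewrite size_map size_iota.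
rewrite -sizeL.
apply: (@zero_free_rho_pm _ x m (k + k + (k + k)) _ _ xrec
  (anti_period_double anti)).
- by rewrite !addn_gt0 k_gt0.
- by apply: uniq_absz_map => i j; rewrite !ltnS; exact: y_inj.
- by move=> v /mapP[j]; rewrite mem_iota add0n ltnS => /andP[_ jk] ->; exact: y_bound.
- have yL j : (j <= k)%N -> y j \in map y (iota 0 k.+1).
    by move=> jk; rewrite map_f // mem_iota.
  have small r : (r < k + k)%N -> exists2 v, v \in map y (iota 0 k.+1) &
      x r =[m]= v \/ x r =[m]= - v.
    move=> rk; have [le_rk|lt_kr] := leqP r k.
      by exists (y r); [exact: yL | left; exact: xy].
    (* Indices between k and 2k are folded back to 2k - r by the reflection at k. *)
    have [j_le rE] : (r - k <= k)%N /\ (k + (r - k) = r)%N by clear -rk lt_kr; lia.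
    exists (y (k - (r - k))%N); first by apply: yL; rewrite leq_subr.
    have := refl _ j_le; rewrite rE; have := xy (k - (r - k))%N (leq_subr _ _).
    move: (k - _)%N => i xyi; rewrite -signr_odd; case: odd.
      rewrite expr1 mulN1r => h; right; exact: cong_trans h (congN xyi).
    by rewrite expr0 mul1r => h; left; exact: cong_trans h xyi.
  move=> j; have kk_gt0 : (0 < k + k)%N by rewrite addn_gt0 k_gt0.
  have [r rk xr] := anti_period_mod kk_gt0 anti j; have [v vL xv] := small r rk.
  exists v => //; case: xr xv => xr [xv|xv].
  + by left; exact: cong_trans xr xv.
  + by right; exact: cong_trans xr xv.
  + by right; exact: cong_trans xr (congN xv).
  + by left; rewrite -[v]opprK; exact: cong_trans xr (congN xv).
move=> v /mapP[j]; rewrite mem_iota add0n ltnS => /andP[_ jk] ->; split.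
  by exists j; exact: xy.
by exists (j + (k + k))%N; exact: cong_trans (anti j) (congN (xy j jk)).
Qed.

(** * Multiples of 4 for a other than 2 *)

Local Notation V a := (lin a 2 a).

Lemma V_gt0 (a : int) n : 1 <= a -> 0 < V a n.
Proof.
move=> a_gt0; suff [] : 0 < V a n /\ 0 < V a n.+1 by [].
elim: n => [|n [IH0 IH1]]; first by split=> //=; lia.
by split=> //; rewrite linSS addr_gt0 // mulr_gt0 //; lia.
Qed.

Lemma V_step (a c : int) n : 1 <= a -> c <= a -> c * V a n.+1 + V a n <= V a n.+2.
Proof. by move=> a_gt0 ca; rewrite linSS lerD2r ler_wpM2r ?(ltW (V_gt0 _ _)). Qed.

Lemma V_ltn (a : int) i j : 1 <= a -> (0 < i)%N -> (i < j)%N -> V a i < V a j.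
Proof.
move=> a_gt0 i_gt0; elim: j => [//|j IH]; rewrite ltnS leq_eqVlt.
have lt_j : (0 < j)%N -> V a j < V a j.+1.
  case: j {IH} => // j _; have := V_step j a_gt0 a_gt0.
  by have := V_gt0 j a_gt0; lia.
case/orP => [/eqP ij|ij]; first by rewrite -ij in lt_j *; exact: lt_j.
by apply: lt_trans (IH ij) (lt_j _); lia.
Qed.

(** V increases from index 1 on, so only V_0 = 2 could recur: it is below V_1 = a for a >= 3, and
    lies strictly between V_1 = 1 and V_2 = 3 for a = 1. *)
Lemma V_neq (a : int) i j : 1 <= a -> a != 2 -> (i < j)%N -> V a i != V a j.
Proof.
move=> a_gt0 a2; case: i => [|i] ij; last first.
  by have := V_ltn a_gt0 (ltn0Sn i) ij; lia.
have [a3|a1] : 3 <= a \/ a = 1 by lia.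
  have : V a 1 <= V a j.
    have [->//|lt1j] : j = 1%N \/ (1 < j)%N by lia.
    by have := V_ltn a_gt0 (ltn0Sn 0) lt1j; lia.
  by rewrite /=; lia.
subst a; case: j ij => [//|[//|j]] _; have : V 1 2 <= V 1 j.+2.
  case: j => [//|j]; have lt2j : (2 < j.+3)%N by lia.
  by have := V_ltn a_gt0 (ltn0Sn 1) lt2j; lia.
by rewrite [V 1 2]/= [V 1 0]/=; lia.
Qed.

(** The right-hand side is a V_k + 2 V_{k-1}. For a = 1 and k >= 3, V_k = V_{k-1} + V_{k-2} < 2
    V_{k-1}; k = 1 is computed. The index j = 0 is treated apart, V not being monotone there. *)
Lemma V_double_lt (a : int) k j : 1 <= a -> a != 2 -> odd k -> (j <= k)%N ->
  2 * V a j < V a k.+1 + V a k.-1.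
Proof.
move=> a_gt0 a2; case: k => [//|k] even_k jk; rewrite (linSS a 2 a k) -[k.+1.-1]/k.
have Vk := V_gt0 k a_gt0; have Vk1 := V_gt0 k.+1 a_gt0.
have le_j : (0 < j)%N -> V a j <= V a k.+1.
  move=> j_gt0; have [->//|lt_jk] : j = k.+1 \/ (j < k.+1)%N by lia.
  by have := V_ltn a_gt0 j_gt0 lt_jk; lia.
have [a3|a1] : 3 <= a \/ a = 1 by lia.
  have j_le : V a j <= V a k.+1.
    case: j jk le_j => [|j] _ le_j; last exact: le_j.
    have : V a 1 <= V a k.+1.
      case: k {even_k Vk Vk1 le_j} => [//|k].
      have lt1k : (1 < k.+2)%N by lia.
      by have := V_ltn a_gt0 (ltn0Sn 0) lt1k; lia.
    by rewrite /=; lia.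
  have : 3 * V a k.+1 <= a * V a k.+1 by rewrite ler_wpM2r ?(ltW Vk1).
  by lia.
subst a; case: k even_k jk Vk Vk1 le_j => [|[//|k]] even_k jk Vk Vk1 le_j.
  by case: j jk {le_j} => [|[|]].
have V2 : V 1 0 < V 1 k.+3.
  have lt2 : (2 < k.+3)%N by lia.
  by have := V_ltn a_gt0 (ltn0Sn 1) lt2; rewrite [V 1 2]/= [V 1 0]/=; lia.
have j_le : V 1 j <= V 1 k.+3.
  by case: j jk le_j => [|j] _ le_j; [exact: ltW | exact: le_j].
have lt_k : V 1 k.+1 < V 1 k.+2 by apply: V_ltn.
by have := linSS 1 2 1 k.+1; lia.
Qed.

Lemma zero_free_rho_V (a : int) k : 1 <= a -> a != 2 -> odd k ->
  zero_free_rho a (2 * k.+1)%N.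
Proof.
move=> a_gt0 a2 odd_k; pose m : nat := `|(V a k.+1 + V a k.-1)%R|%N.
have mE : m%:Z = V a k.+1 + V a k.-1.
  by rewrite gez0_abs // addr_ge0 // ltW // V_gt0.
apply: (@zero_free_rho_symmetric a (V a) m k (V a) odd_k).
- by move=> j; rewrite linSS; exact: cong_refl.
- by rewrite /= mulrC; exact: cong_refl.
- by rewrite opprK mE; exact: dvdzz.
- by move=> j _; exact: cong_refl.
- move=> i j _ _ Vij; have {Vij} : V a i = V a j.
    have := V_gt0 i a_gt0; have := V_gt0 j a_gt0; lia.
  have [//|[ij|ji]] : i = j \/ (i < j)%N \/ (j < i)%N by lia.
    by have := V_neq a_gt0 a2 ij; lia.
  by have := V_neq a_gt0 a2 ji; lia.
move=> j jk; have := V_double_lt a_gt0 a2 odd_k jk; rewrite mE.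
by have := V_gt0 j a_gt0; lia.
Qed.

(** * Multiples of 4 for a = 2 *)

Lemma U2_parity n : exists c, U 2 n = 2 * c + (odd n)%:R.
Proof.
elim/ltn_ind: n => -[|[|n]] IH; first by exists 0.
  by exists 0.
have [|c Ec] := IH n; first by lia.
by exists (U 2 n.+1 + c); rewrite linSS Ec /= negbK; ring.
Qed.

(** The increment of U_{j+1} - U_j is 2 U_j, which vanishes only at j = 0; hence [1 < j]. *)
Lemma U2_sub_ltn i j : (i < j)%N -> (1 < j)%N ->
  U 2 i.+1 - U 2 i < U 2 j.+1 - U 2 j.
Proof.
elim: j => [//|j IH]; rewrite ltnS leq_eqVlt => ij j_gt0.
have lt_j : U 2 j.+1 - U 2 j < U 2 j.+2 - U 2 j.+1.
  have := @U_gt0 2 j isT; rewrite (linSS 2 0 1 j); lia.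
case/orP: ij => [/eqP ->//|ij]; apply: le_lt_trans lt_j.
have [j1|j1] : j = 1%N \/ (1 < j)%N by lia.
  by case: j j1 ij {IH j_gt0} => [//|[|//]] _; case: i.
exact/ltW/IH.
Qed.

(* For a = 2 the first two terms of lin 2 2 2 coincide, so this adds to the
   half-companion sequence U_{j+1} - U_j half of the modulus at odd indices. *)
Lemma zero_free_rho_2 k : (3 <= k)%N -> odd k -> zero_free_rho 2 (2 * k.+1)%N.
Proof.
move=> k3 odd_k.
have Uk : 0 < U 2 k by apply: U_gt0 => //; lia.
pose m : nat := `|(2 * U 2 k)%R|%N.
have mE : m%:Z = 2 * U 2 k by rewrite gez0_abs //; lia.
pose y j : int := U 2 j.+1 - U 2 j - (odd j)%:R * U 2 k.
have [d kE] : exists d, k = d.+3 by exists (k - 3)%N; lia.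
have Ud1 : 0 < U 2 d.+1 by apply: U_gt0.
have Ud2 : 0 < U 2 d.+2 by apply: U_gt0.
have U3 : U 2 k = 2 * U 2 d.+2 + U 2 d.+1 by rewrite kE.
have U4 : U 2 k.+1 = 2 * U 2 k + U 2 d.+2 by rewrite kE.
have yk : y k = U 2 d.+2 by rewrite /y odd_k U4 mul1r; lia.
have Qinj i j : odd i = odd j -> U 2 i.+1 - U 2 i = U 2 j.+1 - U 2 j -> i = j.
  move=> oij Qij; have [//|[ij|ji]] : i = j \/ (i < j)%N \/ (j < i)%N by lia.
    have j1 : (1 < j)%N by case: j oij ij {Qij} => [|[|//]] //; case: i.
    by have := U2_sub_ltn ij j1; rewrite Qij ltxx.
  have i1 : (1 < i)%N by case: i oij ji {Qij} => [|[|//]] //; case: j.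
  by have := U2_sub_ltn ji i1; rewrite Qij ltxx.
have Qodd j : exists c, U 2 j.+1 - U 2 j = 2 * c + 1.
  have [[c ->] [c' ->]] := (U2_parity j, U2_parity j.+1).
  by rewrite /=; case: odd; [exists (c' - c - 1) | exists (c' - c)]; rewrite /=; ring.
have Qpos j : 0 < U 2 j.+1 - U 2 j.
  case: j => [//|j]; have := U_step j (isT : 1 <= 2 :> int) (lexx 2).
  have := @U_ge0 2 j isT; have := @U_gt0 2 j.+1 isT isT; lia.
have y_even j : ~~ odd j -> y j = U 2 j.+1 - U 2 j.
  by move=> /negbTE oj; rewrite /y oj mul0r subr0.
have y_odd j : odd j -> y j = U 2 j.+1 - U 2 j - U 2 k.
  by move=> oj; rewrite /y oj mul1r.
have Qlt j : (j < k.-1)%N -> U 2 j.+1 - U 2 j < U 2 k - U 2 d.+2.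
  move=> jk; have := @U2_sub_ltn j d.+2; rewrite -kE; apply=> //.
  by move: jk; rewrite kE.
have Qle j : (j < k)%N -> U 2 j.+1 - U 2 j <= U 2 k - U 2 d.+2.
  move=> jk; have [jE|jl] : j = d.+2 \/ (j < k.-1)%N by lia.
    by rewrite jE -kE.
  exact/ltW/Qlt.
have odd_lt j : (j <= k)%N -> odd j -> j = k \/ (j < k.-1)%N.
  move=> jk oj; have [->|[jE|jl]] : j = k \/ j = k.-1 \/ (j < k.-1)%N by lia.
  - by left.
  - by move: oj odd_k; rewrite jE kE /=; case: odd.
  - by right.
have even_lt j : (j <= k)%N -> ~~ odd j -> (j < k)%N.
  by rewrite leq_eqVlt => /orP[/eqP ->|//]; rewrite odd_k.
(* The shift by -U_k at odd indices respects the recurrence modulo 2 U_k: for even j it enters as -2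
   U_k through the coefficient 2, for odd j it stands on both sides. *)
have xy j : lin 2 1 (1 - U 2 k) j =[m]= y j.
  suff [] : lin 2 1 (1 - U 2 k) j =[m]= y j /\
    lin 2 1 (1 - U 2 k) j.+1 =[m]= y j.+1 by [].
  elim: j => [|j [IH0 IH1]].
    by split; rewrite /y /= ?mul0r ?mul1r ?subr0; exact: cong_refl.
  split=> //; rewrite linSS; apply: (cong_trans (congD (congM 2 IH1) IH0)).
  rewrite /y (linSS 2 0 1 j.+1) (linSS 2 0 1 j) /=; case: (odd j) => /=.
    by rewrite !(mul1r, mul0r); apply/dvdzP; exists 0; rewrite mul0r; ring.
  by rewrite !(mul1r, mul0r) mE; apply/dvdzP; exists (-1); ring.
apply: (@zero_free_rho_symmetric 2 (lin 2 1 (1 - U 2 k)) m k y odd_k).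
- by move=> j; rewrite linSS; exact: cong_refl.
- rewrite mE; apply/dvdzP; exists (-1); rewrite /=; ring.
- apply: (cong_trans (xy _)); apply: cong_sym; apply: (cong_trans (congN (xy _))).
  have odd_k1 : odd k.-1 = false by move: odd_k; rewrite kE /=; case: odd.
  have ok1 : ~~ odd k.+1 by rewrite /= odd_k.
  rewrite mE (y_even _ ok1) y_even ?odd_k1 // (linSS 2 0 1 k) U4.
  have -> : U 2 k.-1 = U 2 d.+2 by rewrite kE.
  have -> : U 2 k.-1.+1 = U 2 k by rewrite kE.
  (* With Q_j = U_{j+1} - U_j, one has Q_{k+1} + Q_{k-1} = 4 U_k, twice the modulus. *)
  by apply/dvdzP; exists (-2); ring.
- by move=> j _; exact: xy.
- move=> i j ik jk; case oi: (odd i); case oj: (odd j).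
  (* For odd j < k, y_j < -U_{k-1}, whereas y_k = U_{k-1}; so y_k is smallest in absolute value
     among the odd indices. *)
  + rewrite !y_odd // => yij.
    have [iE|il] := odd_lt i ik oi; have [jE|jl] := odd_lt j jk oj.
    * by rewrite iE jE.
    * have := Qlt j jl; have := Qpos j; move: yij; rewrite iE U4.
      by clear -Ud2 Uk; lia.
    * have := Qlt i il; have := Qpos i; move: yij; rewrite jE U4.
      by clear -Ud2 Uk; lia.
    apply: Qinj; first by rewrite oi.
    have := Qlt j jl; have := Qlt i il; move: yij; clear -Ud2 Uk; lia.
  (* Parity separates the two kinds of index: U_k is odd, so y is even at odd indices and odd at
     even ones. *)
  + rewrite y_odd // y_even ?oj //.
    have [[c ->] [c' ->]] := (Qodd i, Qodd j).
    by have [e ->] := U2_parity k; rewrite odd_k; clear; lia.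
  + rewrite (y_even i) ?oi // y_odd //.
    have [[c ->] [c' ->]] := (Qodd i, Qodd j).
    by have [e ->] := U2_parity k; rewrite odd_k; clear; lia.
  rewrite !y_even ?oi ?oj // => yij; apply: Qinj; first by rewrite oi.
  by have := Qpos i; have := Qpos j; move: yij; clear; lia.
move=> j jk; rewrite mE; case oj: (odd j).
  have [->|jl] := odd_lt j jk oj; first by rewrite yk; clear -Ud2 Ud1 U3; lia.
  by rewrite y_odd //; have := Qpos j; have := Qlt j jl; clear -Ud2; lia.
have := Qpos j; have := Qle j (even_lt j jk (negbT oj)).
by rewrite y_even ?oj //; clear -Ud2; lia.
Qed.

(** * Small cases and the existence result *)

(** Two congruences certify the period, after which every condition is a finite check for
    [vm_compute]. *)
Lemma zero_free_rho_lin (a x0 x1 : int) (m P : nat) (L : seq int) :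
  let x := lin a x0 x1 in
  [&& (0 < P)%N, (m%:Z %| x P - x 0%N)%Z, (m%:Z %| x P.+1 - x 1%N)%Z, uniq L,
      all (fun v => (v != 0) && (- m%:Z < 2 * v <= m%:Z)) L,
      all (fun j => has (fun v => (m%:Z %| x j - v)%Z) L) (iota 0 P) &
      all (fun v => has (fun j => (m%:Z %| x j - v)%Z) (iota 0 P)) L] ->
  zero_free_rho a (size L).
Proof.
move=> x /and5P[P_gt0 xP xP1 uL /and3P[/allP bL /allP xL /allP Lx]].
have xrec j : x j.+2 =[m]= a * x j.+1 + x j by rewrite /x linSS; exact: cong_refl.
have per j : x (j + P)%N =[m]= x j.
  by rewrite -[x j]mul1r; apply: (lin_period xrec); rewrite mul1r.
apply: (zero_free_rhoI P_gt0 xrec per) => //.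
- by move=> v /bL /andP[].
- move=> j; have [r rP xr] := period_mod P_gt0 per j.
  have /xL /hasP[v vL xv] : r \in iota 0 P by rewrite mem_iota.
  by exists v => //; exact: cong_trans xr xv.
by move=> v /Lx /hasP[j _ xv]; exists j.
Qed.

(** The cases are n odd, n divisible by 4, and n twice an odd number. The pairs (a, n) computed
    directly, (2, 1), (2, 4), (1, 6) and (2, 2), are those that the general constructions leave
    out. *)
Lemma zero_free_rho_pos (a : int) (n : nat) : 1 <= a -> (1 <= n)%N ->
  (a = 1 -> (4 <= n)%N) -> zero_free_rho a n.
Proof.
move=> a_gt0 n_gt0 a1.
have [odd_n|/negbTE even_n] := boolP (odd n).
  have [[-> ->]|small] : (a = 2 /\ n = 1%N) \/ ~ (a = 2 /\ n = 1%N) by lia.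
    by apply: (@zero_free_rho_lin 2 1 1 2 1 [:: 1]); vm_compute.
  by apply: (proj1 (zero_free_rho_odd a_gt0 odd_n _ _)); lia.
have [k nE] : exists k, n = (2 * k.+1)%N by exists n./2.-1; lia.
have [even_k|odd_k] := boolP (~~ odd k); last first.
  rewrite negbK in odd_k; have [a2|a2] := eqVneq a 2; last first.
    by rewrite nE; exact: zero_free_rho_V.
  have [k1|k3] : k = 1%N \/ (3 <= k)%N by lia.
    rewrite nE a2 k1.
    by apply: (@zero_free_rho_lin 2 1 1 5 12 [:: 1; 2; -1; -2]); vm_compute.
  by rewrite nE a2; exact: zero_free_rho_2.
have [[-> n6]|not6] : (a = 1 /\ n = 6%N) \/ ~ (a = 1 /\ n = 6%N) by lia.
  rewrite n6.
  (* The Lucas numbers 1, 3, 4, 7, ... modulo 8 miss exactly 0 and 6. *)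
  by apply: (@zero_free_rho_lin 1 1 3 8 12 [:: 1; 2; 3; 4; -3; -1]); vm_compute.
have [[-> n2]|not2] : (a = 2 /\ n = 2%N) \/ ~ (a = 2 /\ n = 2%N) by lia.
  by rewrite n2; apply: (@zero_free_rho_lin 2 1 1 4 4 [:: 1; -1]); vm_compute.
rewrite nE; apply: (proj2 (zero_free_rho_odd a_gt0 _ _ _)) => //=; lia.
Qed.

Lemma zero_free_rho_all (a : int) (n : nat) : (1 <= n)%N ->
  (`|a| = 1 /\ (4 <= n)%N) \/ 2 <= `|a| -> zero_free_rho a n.
Proof.
move=> n_gt0 an; have [a_gt0|a_lt0] : 1 <= a \/ 1 <= - a by lia.
  by apply: zero_free_rho_pos => //; lia.
by rewrite -[a]opprK; apply/zero_free_rhoN/zero_free_rho_pos => //; lia.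
Qed.

(** * At least four residues when |a| = 1 *)

Lemma rho_ge_size x m (s : seq nat) : (0 < m)%N ->
  {in s &, forall i j, x i =[m]= x j -> i = j} -> uniq s -> (size s <= rho x m)%N.
Proof.
case: m => // m _ xs us; pose f j : 'I_m.+1 := inord `|(x j %% m.+1%:Z)%Z|%N.
have fE j : (f j)%:Z = (x j %% m.+1%:Z)%Z.
  have x_ge0 : 0 <= (x j %% m.+1%:Z)%Z by rewrite modz_ge0.
  have x_lt : (x j %% m.+1%:Z)%Z < m.+1%:Z by rewrite ltz_pmod.
  by rewrite inordK ?gez0_abs // -ltz_nat gez0_abs.
have f_inj : {in s &, injective f}.
  move=> i j si sj fij; apply: xs => //.
  by rewrite -eqz_mod_dvd -!fE fij.
rewrite -(size_map f) -(card_uniqP (_ : uniq (map f s))) ?map_inj_in_uniq //.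
apply/subset_leq_card/subsetP => _ /mapP[j _ ->].
by rewrite inE; apply/asboolP; exists j; rewrite fE.
Qed.

(* Three consecutive terms are pairwise incongruent, so with at most three
   residues the sequence has period 3, which forces 2 x_2 = 2 x_3 = 0. *)
Lemma rho_ge4 (a : int) x m : `|a| = 1 -> (0 < m)%N -> inL a x ->
  (forall j, ~~ (m%:Z %| x j)%Z) -> (4 <= rho x m)%N.
Proof.
move=> a1 m_gt0 xL xn0; rewrite leqNgt; apply/negP => rho_lt.
have {}a1 : a = 1 \/ a = -1 by lia.
(* The difference is x_j for a = 1 and -x_{j+3} for a = -1. *)
have adj j : ~ (x j.+2 =[m]= x j.+1).
  move=> xx; case: a1 xL => -> xL.
    have E : x j = x j.+2 - x j.+1 by rewrite xL; ring.
    by have := xn0 j; rewrite E xx.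
  have E : x j.+3 = - (x j.+2 - x j.+1) by rewrite (xL j.+1); ring.
  by have := xn0 j.+3; rewrite E rpredN xx.
have adj2 j : ~ (x j.+2 =[m]= x j).
  move=> xx; have E : x j.+1 = a * (x j.+2 - x j).
    by rewrite xL; case: a1 => ->; ring.
  by have := xn0 j.+1; rewrite E dvdz_mull.
(* Among four consecutive terms the outer two are the only pair that can still coincide. *)
have per j : x j.+4 =[m]= x j.+1.
  apply: contraT => xx; move: rho_lt.
  rewrite ltnNge -[4%N]/(size [:: j.+1; j.+2; j.+3; j.+4]) rho_ge_size //=.
    move=> i k; rewrite !inE => /or4P[]/eqP-> /or4P[]/eqP-> h; first [by [] |
      case: (adj _ h) | case: (adj2 _ h) | case: (adj _ (cong_sym h)) |
      case: (adj2 _ (cong_sym h)) | case: (negP xx h) | case: (negP xx (cong_sym h))].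
  by rewrite !inE; lia.
have [d2 d3] : (m%:Z %| 2 * x 2%N)%Z /\ (m%:Z %| 2 * x 3%N)%Z.
  have [p0 p1] := (per 0%N, per 1%N).
  case: a1 xL => -> xL.
    have -> : 2 * x 2%N = x 4%N - x 1%N by rewrite !xL; ring.
    by have -> : 2 * x 3%N = x 5%N - x 2%N by rewrite !xL; ring.
  have -> : 2 * x 2%N = - ((x 4%N - x 1%N) + (x 5%N - x 2%N)) by rewrite !xL; ring.
  have -> : 2 * x 3%N = - (x 4%N - x 1%N) by rewrite !xL; ring.
  by rewrite !rpredN rpredD.
(* As m does not divide x_j, the quotient is odd: x_j is m / 2 modulo m. Holding for both x_2 and
   x_3, this makes them congruent, against [adj]. *)
have half j : (m%:Z %| 2 * x j)%Z -> exists c, 2 * x j = (2 * c + 1) * m%:Z.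
  case/dvdzP => c Ec; have [d [cE|cE]] : exists d, c = 2 * d \/ c = 2 * d + 1.
  - by exists (c %/ 2)%Z; lia.
  - exfalso; have := xn0 j; suff -> : x j = d * m%:Z by rewrite dvdz_mull.
    by move: Ec; rewrite cE; nia.
  by exists d; rewrite Ec cE.
have [[c Ec] [d Ed]] := (half _ d2, half _ d3).
case: (adj 1%N); apply/dvdzP; exists (d - c).
by clear -Ec Ed; nia.
Qed.

(** * Positivity, the values up to 3, and the conclusion *)

Lemma rho_gt0 x m : (0 < m)%N -> (0 < rho x m)%N.
Proof.
move=> m_gt0; apply: (@rho_ge_size x m [:: 0%N] m_gt0) => // i j.
by rewrite !inE => /eqP-> /eqP->.
Qed.

(** For |a| = 1 these values come from a sequence containing 0: U meets all residues modulo n <= 3,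
    with -1 met as U_3 = 2 for a = 1 and as U_2 for a = -1. *)
Lemma rho_small (a : int) n : `|a| = 1 -> (1 <= n <= 3)%N ->
  rho (lin a 0 1) n = n.
Proof.
move=> a1 n13.
have {n13} [->|[->|->]] : n = 1%N \/ n = 2%N \/ n = 3%N by lia.
- apply: (@rho_size _ _ [:: 0]) => //.
  + by move=> v; rewrite inE => /eqP->.
  + by move=> j; exists 0; rewrite ?inE // subr0 dvd1z.
  by move=> v; rewrite inE => /eqP->; exists 0%N.
- apply: (@rho_size _ _ [:: 0; 1]) => //.
  + by move=> v; rewrite !inE => /orP[]/eqP->.
  + move=> j; move: (lin _ _ _ j) => y.
    have [e|e] : (2 %| y - 0)%Z \/ (2 %| y - 1)%Z by lia.
      by exists 0.
    by exists 1.
  by move=> v; rewrite !inE => /orP[]/eqP->; [exists 0%N | exists 1%N].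
apply: (@rho_size _ _ [:: 0; 1; -1]) => //.
- by move=> v; rewrite !inE => /or3P[]/eqP->.
- move=> j; move: (lin _ _ _ j) => y.
  have [e|[e|e]] : (3 %| y - 0)%Z \/ (3 %| y - 1)%Z \/ (3 %| y - -1)%Z by lia.
  + by exists 0.
  + by exists 1.
  by exists (-1).
move=> v; rewrite !inE => /or3P[]/eqP->; [by exists 0%N | by exists 1%N |].
have [->|->] : a = 1 \/ a = -1 by lia.
  by exists 3%N.
by exists 2%N.
Qed.

Theorem theorem1 (a1 : int) (ha1 : a1 != 0) :
  (* R(f) = Z^+ : every value of rho is positive, and every positive n is attained *)
  ((forall (x : nat -> int) (m : nat), inL a1 x -> (0 < m)%N -> (0 < rho x m)%N) /\
   (forall n : nat, (1 <= n)%N ->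
      exists (x : nat -> int) (m : nat), inL a1 x /\ (1 <= m)%N /\ rho x m = n)) /\
  (* refinement with no term of x divisible by m *)
  (forall n : nat, (1 <= n)%N ->
     ((exists (x : nat -> int) (m : nat),
         [/\ inL a1 x, (1 <= m)%N, rho x m = n &
             forall j : nat, ~~ (m%:Z %| x j)%Z])
      <-> ((`|a1| = 1 /\ (4 <= n)%N) \/ 2 <= `|a1|))).
Proof.
split; last first.
  move=> n n_gt0; split=> [[x [m [xL m_gt0 <- xn0]]]|an].
    have [a_1|a_2] : `|a1| = 1 \/ 2 <= `|a1| by lia.
      by left; split=> //; exact: rho_ge4 xL xn0.
    by right.
  exact/zero_free_rho_inL/zero_free_rho_all.
split=> [x m _|n n_gt0]; first exact: rho_gt0.
have [an|[a_1 n3]] : ((`|a1| = 1 /\ (4 <= n)%N) \/ 2 <= `|a1|) \/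
    (`|a1| = 1 /\ (n <= 3)%N) by lia.
  have [x [m [xL m_gt0 xn _]]] := zero_free_rho_inL (zero_free_rho_all n_gt0 an).
  by exists x, m.
exists (lin a1 0 1), n; split; first by move=> j; exact: linSS.
by split=> //; apply: rho_small; rewrite ?n_gt0.
Qed.
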